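(* Let $\mathbb{V}$ be a finite-dimensional non-zero vector space over a field $\mathbb{F}$ with basis $\{\alpha_1,\ldots,\alpha_n\}$. Then the domination number of the non-zero component graph $\Gamma(\mathbb{V}_\alpha)$ is $1$.
   Context: Let $\theta$ be the null vector of $\mathbb{V}$. Every $\mathbf{a}\in\mathbb{V}$ is written uniquely as $\mathbf{a}=a_1\alpha_1+\cdots+a_n\alpha_n$ with $a_i\in\mathbb{F}$. The non-zero component graph $\Gamma(\mathbb{V}_\alpha)$ with respect to the basis $\{\alpha_1,\ldots,\alpha_n\}$ is the simple graph with vertex set $\mathbb{V}\setminus\{\theta\}$ in which two distinct vertices $\mathbf{a},\mathbf{b}$ are adjacent if and only if there is an index $i$ with $a_i\neq 0$ and $b_i\neq 0$. The field may be finite or infinite. A set $D$ of vertices is dominating if every vertex not in $D$ is adjacent to at least one vertex of $D$; the domination number is the minimum size of a dominating set. *)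

(* Defs.v *)
From mathcomp Require Import all_boot all_algebra.
From mathcomp Require Import all_classical.

Set Implicit Arguments.
Unset Strict Implicit.
Unset Printing Implicit Defensive.

Import GRing.Theory.

Local Open Scope ring_scope.
Local Open Scope classical_set_scope.
Local Open Scope card_scope.

(* The vertex type may be infinite. *)
Record simple_graph := SimpleGraph {
  vertex :> Type;
  adj : vertex -> vertex -> Prop;
  adj_sym : forall x y, adj x y -> adj y x;
  adj_irrefl : forall x, ~ adj x x }.

Definition dominating (G : simple_graph) (D : set G) : Prop :=
  forall x : G, ~ D x -> exists2 y : G, D y & adj x y.

(* Minimality ranges over all dominating sets, finite or infinite, sizes being
   compared as cardinals; at most one natural number k satisfies this. *)
Definition is_domination_number (G : simple_graph) (k : nat) : Prop :=
  (exists2 D : set G, dominating D & D #= `I_k) /\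
  (forall D : set G, dominating D -> `I_k #<= D).

Section NonZeroComponentGraph.
Variables (F : fieldType) (V : vectType F) (n : nat) (alpha : n.-tuple V).

Definition nonzero_vector := {v : V | v != 0}.

(* When alpha is a basis of V, coord alpha i v is the coefficient of alpha_i
   in the expansion of v. *)
Definition nzc_adj (a b : nonzero_vector) : Prop :=
  a <> b /\
  exists i : 'I_n, coord alpha i (val a) <> 0 /\ coord alpha i (val b) <> 0.

Lemma nzc_adj_sym a b : nzc_adj a b -> nzc_adj b a.
Proof.
by case=> ab [i [ai bi]]; split; [move=> ba; apply: ab | exists i].
Qed.

Lemma nzc_adj_irrefl a : ~ nzc_adj a a.
Proof. by case. Qed.

Definition nonzero_component_graph : simple_graph :=
  SimpleGraph nzc_adj_sym nzc_adj_irrefl.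

End NonZeroComponentGraph.

(* Main.v *)
(* The vector whose components are all 1 is adjacent to every other vertex, since
   every non-zero vector has a non-zero component; it exists because the basis is
   non-empty. *)
Require Import Defs.
From mathcomp Require Import all_boot all_algebra.
From mathcomp Require Import all_classical.

Set Implicit Arguments.
Unset Strict Implicit.
Unset Printing Implicit Defensive.

Import GRing.Theory.

Local Open Scope ring_scope.

(** Since a basis is free, every coordinate of the sum of the [alpha_j] is 1 ([coord_sum_free1]), so
    this vector shares a non-zero component with any non-zero vector ([coord_basis_neq0]). It is
    thus a vertex adjacent to all others, and [domination_number1] concludes for any graph with such
    a vertex. *)

Lemma domination_number1 (G : simple_graph) (x : G) :
  (forall y, y <> x -> adj y x) -> is_domination_number G 1%N.
Proof.
move=> x_adj; split=> [|D domD].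
  exists [set x]%classic; last exact: card_set1.
  by move=> y yx; exists x => //; exact: x_adj.
(* Lower bound: cardinality at least 1 only asks for a point of [D]. *)
suff [y Dy] : exists y, D y.
  apply/card_subP; exists [set y]%classic; first exact: card_set1.
  by move=> _ ->.
(* Either [x] lies in [D], or some element of [D] dominates it. *)
case: (pselect (D x)) => [Dx|/domD[y Dy _]]; [by exists x | by exists y].
Qed.

Lemma coord_basis_neq0 (F : fieldType) (V : vectType F) (n : nat)
    (alpha : n.-tuple V) (v : V) :
  basis_of fullv alpha -> v != 0 -> exists i, coord alpha i v != 0.
Proof.
move=> alpha_basis v_neq0; apply/existsP; apply: contraNT v_neq0.
rewrite negb_exists => /forallP v0.
rewrite (coord_basis alpha_basis (memvf v)) big1// => i _.
by rewrite (eqP (negbNE (v0 i))) scale0r.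
Qed.

Lemma coord_sum_free1 (F : fieldType) (V : vectType F) (n : nat)
    (alpha : n.-tuple V) (i : 'I_n) :
  free alpha -> coord alpha i (\sum_(j < n) alpha`_j) = 1.
Proof.
move=> alpha_free; under eq_bigr do rewrite -[alpha`__]scale1r.
by rewrite coord_sum_free.
Qed.

Lemma sum_basis_neq0 (F : fieldType) (V : vectType F) (n : nat)
    (alpha : n.-tuple V) :
  basis_of fullv alpha -> fullv != 0%VS :> {vspace V} ->
  \sum_(j < n) alpha`_j != 0.
Proof.
(* The non-zero vector [vpick fullv] serves only to produce an index [i], so that the sum is not
   empty; its coordinate at [i] is then 1, not 0. *)
move=> alpha_basis; rewrite -vpick0 => /(coord_basis_neq0 alpha_basis)[i _].
apply: contra_eq_neq (coord_sum_free1 i (basis_free alpha_basis)) => ->.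
by rewrite linear0 eq_sym oner_neq0.
Qed.

Theorem theorem4p3 (F : fieldType) (V : vectType F) (n : nat)
    (alpha : n.-tuple V) (V_neq0 : fullv != 0%VS :> {vspace V})
    (alpha_basis : basis_of (fullv : {vspace V}) alpha) :
  is_domination_number (nonzero_component_graph alpha) 1%N.
Proof.
pose s : nonzero_vector V :=
   exist (fun v => v != 0) _ (sum_basis_neq0 alpha_basis V_neq0).
apply: (@domination_number1 (nonzero_component_graph alpha) s) => a a_neq_s.
split=> //; have [i ai] := coord_basis_neq0 alpha_basis (valP a).
exists i; split; first exact/eqP.
by rewrite (coord_sum_free1 i (basis_free alpha_basis)); apply/eqP/oner_neq0.
Qed.
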